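(* Let $\widetilde V$ be a real vector space with $\dim\widetilde V=\tilde n<\infty$, let $\mathtt c$ be a symmetric positive semi-definite bilinear form on $\widetilde V$ with $\ker\mathtt c:=\{v\in\widetilde V:\mathtt c(v,w)=0\ \text{for all}\ w\in\widetilde V\}$ and $s:=\dim\ker\mathtt c<\tilde n$, and let $\mathtt b$ be a symmetric (possibly indefinite) bilinear form on $\widetilde V$. Consider the generalised eigenvalue problem: find $\lambda\in\mathbb R$ and $p\in\widetilde V\setminus\{0\}$ such that $$\mathtt b(p,v)=\lambda\,\mathtt c(p,v)\qquad\text{for all }v\in\widetilde V.$$ If $s\ge1$, suppose also that $\mathtt b$ is positive definite on $\ker\mathtt c$. Then $\widetilde V$ has a basis $\{p_j:j=1,\dots,\tilde n\}$ in which $p_1,\dots,p_{\tilde n-s}$ are eigenvectors of this problem, which can be chosen orthonormal with respect to $\mathtt c$, whose corresponding finite eigenvalues can be ordered as $$-\infty<\lambda_1\le\lambda_2\le\dots\le\lambda_{\tilde n-s}<\infty,$$ and in which the remaining vectors $p_{\tilde n-s+1},\dots,p_{\tilde n}$ form a basis of $\ker\mathtt c$. Moreover, for all $j\in\{1,\dots,\tilde n-s\}$ and $j'\in\{1,\dots,\tilde n\}$, $$\mathtt b(p_j,p_{j'})=\lambda_j\delta_{j,j'},\qquad \mathtt c(p_j,p_{j'})=\delta_{j,j'}.$$ If $s=0$, the same conclusion holds without any positive definiteness condition on $\mathtt b$, and all eigenvalues are finite.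
   Context: The vectors $p_{\tilde n-s+1},\dots,p_{\tilde n}$ forming a basis of $\ker\mathtt c$ are said to correspond to infinite eigenvalues; this is terminology only. $\delta_{j,j'}$ is the Kronecker delta. *)

(* Defs.v *)
From HB Require Import structures.
From mathcomp Require Import all_boot all_order all_algebra.
From mathcomp Require Import reals.

Set Implicit Arguments.
Unset Strict Implicit.
Unset Printing Implicit Defensive.

Import Order.TTheory GRing.Theory Num.Theory.
Local Open Scope ring_scope.

Section Forms.
Variables (R : realType) (V : vectType R).

(* [orthov c U] is the subspace of all v such that c v w = 0 for all w in U;
   see [mem_form_kerP]. *)
Definition form_ker (c : {symmetric V}) : {vspace V} := orthov c fullv.

Lemma mem_form_kerP (c : {symmetric V}) (v : V) :
  reflect (forall w, c v w = 0) (v \in form_ker c).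
Proof.
apply: (iffP mem_orthovP) => [h w|h w _]; last exact: h.
by apply: h; rewrite memvf.
Qed.

Definition pos_semidef (c : {symmetric V}) : Prop := forall v, 0 <= c v v.

Definition pos_def_on (U : {vspace V}) (b : {symmetric V}) : Prop :=
  forall v, v \in U -> v != 0 -> 0 < b v v.

Definition gen_eigenpair (b c : {symmetric V}) (lambda : R) (p : V) : Prop :=
  p != 0 /\ forall v, b p v = lambda * c p v.

End Forms.

(* Main.v *)
Require Import Defs.
From HB Require Import structures.
From mathcomp Require Import all_boot all_order all_algebra.
From mathcomp Require Import reals.
From mathcomp Require Import complex lra.

Set Implicit Arguments.
Unset Strict Implicit.
Unset Printing Implicit Defensive.

Import Order.TTheory GRing.Theory Num.Theory.
Local Open Scope ring_scope.

(** The kernel of [c] carries no finite eigenvalue, so the problem has to be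
    moved to a complement of it on which [c] is positive definite.  The right
    complement is [W], the [b]-orthogonal of [ker c]: since [b] is positive
    definite on [ker c], [V] is the direct sum of [W] and [ker c]
    ([orthov_pos_def_split]), and since an isotropic vector of a positive
    semi-definite form lies in its kernel ([psd_isotropic_mem_ker]), [c] is
    positive definite on [W].  Orthogonality for [b] is what makes the reduction
    exact: if [p] is in [W] and [k] in [ker c], then [b p k] and [c p k] both
    vanish, so an eigenvector of the problem restricted to [W] is an eigenvector
    on all of [V].

    On [W] the statement is the spectral theorem for a pencil with positive
    definite [c] ([exists_orthonormal_eigenbasis]), proved by splitting off one
    eigenvector at a time: if [p] is an eigenvector, its [c]-orthogonal in [W]
    is also [b]-orthogonal to [p], and the induction proceeds there.  The
    existence of a single eigenvector is where the reals are used.  Written in a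
    basis of [W], the pencil has a complex eigenvector, whose real and imaginary
    parts [u] and [v] satisfy a pair of coupled real equations
    ([pencil_invariant_pair]); symmetry of [b] and [c] turns these into
    [be * (c u u + c v v) = 0], where [be] is the imaginary part of the
    eigenvalue.  Positivity of [c] gives [be = 0], and the nonzero one of [u]
    and [v] is a real eigenvector.

    For a [c]-unit eigenvector [p] the eigenvalue is [b p p]; eigenvalues are
    therefore never stored alongside the eigenvectors, and ordering them amounts
    to sorting the basis by [b p p]. *)

(** * Existence of an eigenvector *)

(** The complex matrix has an eigenvalue [al + i be] with eigenvector
    [x + i y]; the two equations are the real and imaginary parts of the
    eigenvalue equation. *)
Lemma real_invariant_pair (R : rcfType) m (A : 'M[R]_m) :
  (0 < m)%N ->
  exists (al be : R) (x y : 'rV[R]_m),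
    [/\ (x != 0) || (y != 0),
        x *m A = al *: x - be *: y & y *m A = al *: y + be *: x].
Proof.
move=> m_gt0; pose AC := map_mx (real_complex R) A.
have [a /eigenvalueP[z zA z_neq0]] := eigenvalue_closed AC m_gt0.
pose x := map_mx (@complex.Re R) z; pose y := map_mx (@complex.Im R) z.
have zA_j j : \sum_i z 0 i * (real_complex R (A i j)) = a * z 0 j.
  have /matrixP/(_ 0 j) := zA; rewrite !mxE => <-.
  by apply: eq_bigr => i _; rewrite mxE.
exists (complex.Re a), (complex.Im a), x, y; split.
- apply: contraNT z_neq0; rewrite negb_or !negbK => /andP[/eqP x0 /eqP y0].
  apply/eqP/rowP => i; have /rowP/(_ i) := x0; have /rowP/(_ i) := y0.
  by rewrite !mxE; case: (z 0 i) => u v /= -> ->.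
- apply/rowP => j; have := congr1 (@complex.Re R) (zA_j j).
  rewrite !mxE (raddf_sum (@complex.Re R : Rcomplex R -> R)) /=.
  under eq_bigr => i _.
    rewrite (_ : complex.Re _ = x 0 i * A i j); last first.
      by rewrite mxE; case: (z 0 i) => u v /=; rewrite mulr0 subr0.
    over.
  by move=> ->; case: a {zA zA_j} (z 0 j) => [p q] [u v].
- apply/rowP => j; have := congr1 (@complex.Im R) (zA_j j).
  rewrite !mxE (raddf_sum (@complex.Im R : Rcomplex R -> R)) /=.
  under eq_bigr => i _.
    rewrite (_ : complex.Im _ = y 0 i * A i j); last first.
      by rewrite mxE; case: (z 0 i) => u v /=; rewrite mulr0 add0r.
    over.
  by move=> ->; case: a {zA zA_j} (z 0 j) => [p q] [u v].
Qed.

Section SymmetricForms.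
Variables (R : realType) (V : vectType R).
Implicit Types (b c f : {symmetric V}) (U W : {vspace V}) (s : seq V).

Lemma sym_formC f u v : f u v = f v u.
Proof. by rewrite (hermC f) mul1r. Qed.

Lemma form_coordl f m (X : m.-tuple V) (x : 'rV[R]_m) w :
  f (\sum_i x 0 i *: X`_i) w = \sum_i x 0 i * f X`_i w.
Proof. by rewrite linear_sumlz; apply: eq_bigr => i _; rewrite linearZl. Qed.

(** [real_invariant_pair] applied to [B C^-1], with [B] and [C] the Gram
    matrices of [b] and [c] in a basis of [W].  This matrix is usually not
    symmetric, so the eigenvalue cannot be seen to be real at this stage. *)
Lemma pencil_invariant_pair b c W :
  W != 0%VS -> pos_def_on W c ->
  exists al be u v, [/\ u \in W, v \in W, (u != 0) || (v != 0) &
    {in W, forall w, b u w = al * c u w - be * c v w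
                  /\ b v w = al * c v w + be * c u w}].
Proof.
rewrite -dimv_eq0 -lt0n => W_gt0 c_pd; set m : nat := \dim W in W_gt0.
pose X := vbasis W; have Xfree : free X := basis_free (vbasisP W).
pose vec (x : 'rV[R]_m) := \sum_i x 0 i *: X`_i.
pose G f := \matrix_(i < m, j < m) f X`_i X`_j.
have XW (i : 'I_m) : X`_i \in W.
  by rewrite vbasis_mem// mem_nth// size_tuple.
have vecW x : vec x \in W by apply: memv_suml => i _; rewrite memvZ.
have vec_eq0 x : vec x = 0 -> x = 0.
  move=> vx0; apply/rowP => i; rewrite mxE.
  have /freeP free_eq0 := Xfree; exact: (free_eq0 (fun i => x 0 i) vx0).
have formG f x (j : 'I_m) : f (vec x) X`_j = (x *m G f) 0 j.
  by rewrite form_coordl mxE; apply: eq_bigr => i _; rewrite mxE.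
(* A row [x] killed by the Gram matrix of [c] gives a vector of [W] orthogonal
   to itself. *)
have unitG : G c \in unitmx.
  rewrite -row_free_unit -kermx_eq0; apply/rowV0P => x /sub_kermxP xG0.
  apply: vec_eq0; apply/eqP/negPn/negP => /(c_pd _ (vecW x)).
  rewrite {2}/vec linear_sumr big1 ?ltxx// => i _.
  by rewrite linearZr /= formG xG0 mxE /= mulr0.
have [al [be [x [y [xy_neq0 xA yA]]]]] :=
  real_invariant_pair (G b *m invmx (G c)) W_gt0.
exists al, be, (vec x), (vec y); split=> //.
  by case/orP: xy_neq0 => nz; apply/orP; [left|right];
     apply: contra nz => /eqP/vec_eq0 ->.
(* Right multiplication by [G c] clears the inverse; testing against the basis
   vectors then suffices, by linearity in [w]. *)
have mulG (p q r : 'rV_m) k l : p *m (G b *m invmx (G c)) = k *: q + l *: r ->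
    {in W, forall w, b (vec p) w = k * c (vec q) w + l * c (vec r) w}.
  rewrite mulmxA => /(congr1 (mulmx^~ (G c))).
  rewrite mulmxKV// mulmxDl -!scalemxAl => pG w /coord_vbasis->.
  rewrite !linear_sumr !mulr_sumr -big_split /=; apply: eq_bigr => i _.
  rewrite !linearZr /= !formG pG !mxE /= mulrDr.
  by rewrite !(mulrCA k) !(mulrCA l).
move=> w wW; split; last exact: mulG.
by rewrite -mulNr; apply: (mulG) => //; rewrite scaleNr.
Qed.

(** Computing [b u v] and [b v u] from the coupled equations and equating them
    gives [be * (c u u + c v v) = 0], so the eigenvalue is real. *)
Lemma exists_eigenvector b c W :
  W != 0%VS -> pos_def_on W c ->
  exists p lam, [/\ p \in W, p != 0 & {in W, forall w, b p w = lam * c p w}].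
Proof.
move=> W_neq0 c_pd.
have [al [be [u [v [uW vW uv_neq0 eig]]]]] :=
  pencil_invariant_pair b W_neq0 c_pd.
have c_ge0 w : w \in W -> 0 <= c w w.
  by move=> wW; have [->|/(c_pd _ wW)/ltW//] := eqVneq w 0; rewrite linear0l.
have c_gt0 : 0 < c u u + c v v.
  case/orP: uv_neq0 => nz.
    by rewrite ltr_wpDr ?c_ge0// c_pd.
  by rewrite ltr_wpDl ?c_ge0// c_pd.
have be0 : be = 0.
  have [buv _] := eig v vW; have [_ bvu] := eig u uW.
  move: bvu; rewrite (sym_formC b v u) buv (sym_formC c v u) => E.
  have /eqP : be * (c u u + c v v) = 0 by move: E; lra.
  by rewrite mulf_eq0 (gt_eqF c_gt0) orbF => /eqP.
case/orP: uv_neq0 => nz; [exists u, al|exists v, al]; split=> // w /eig[bu bv].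
  by rewrite bu be0 mul0r subr0.
by rewrite bv be0 mul0r addr0.
Qed.

(** Normalising the eigenvector lets its eigenvalue be read off as [b p p]. *)
Lemma exists_unit_eigenvector b c W :
  W != 0%VS -> pos_def_on W c ->
  exists p, [/\ p \in W, c p p = 1 & {in W, forall w, b p w = b p p * c p w}].
Proof.
move=> W_neq0 c_pd.
have [p0 [lam [p0W p0_neq0 eig0]]] := exists_eigenvector b W_neq0 c_pd.
have cp0 := c_pd _ p0W p0_neq0.
pose p := (Num.sqrt (c p0 p0))^-1 *: p0.
have pW : p \in W by rewrite memvZ.
have cpp : c p p = 1.
  rewrite linearZl linearZr /= mulrA -invfM -expr2 sqr_sqrtr ?ltW//.
  by rewrite mulVf// gt_eqF.
have eig : {in W, forall w, b p w = lam * c p w}.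
  by move=> w wW; rewrite !linearZl /= eig0// mulrCA.
by exists p; split=> // w wW; rewrite !eig// cpp mulr1.
Qed.

(** * Orthonormal families and orthogonal complements *)

(** Fourier expansion: subtracting the coordinates of [v] along an
    [f]-orthonormal basis of [U] leaves a vector orthogonal to [U]. *)
Lemma sub_proj_orthov f U s v :
  basis_of U s -> {in s &, forall p q, f p q = (p == q)%:R} ->
  v - \sum_(p <- s) f v p *: p \in orthov f U.
Proof.
move=> sU fs; have s_uniq := free_uniq (basis_free sU).
suff /subvP sub : (U <= orthov f <[v - \sum_(p <- s) f v p *: p]>)%VS.
  by apply/mem_orthovP => u /sub; rewrite mem_orthov1 sym_formC => /eqP.
rewrite -(span_basis sU); apply/span_subvP => q qs.
rewrite mem_orthov1 linearBr linear_sumr.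
rewrite (bigD1_seq q)//= linearZr /= (fs q q)//.
rewrite eqxx mulr1 (sym_formC f q) big_seq_cond big1 ?addr0 ?subrr//.
move=> p /andP[ps pq].
by rewrite linearZr /= (fs q p)// eq_sym (negbTE pq) mulr0.
Qed.

(** Induction on the dimension of [W].  The complement [W'] of a unit
    eigenvector [p] is taken orthogonal for [c], but [b p w = b p p * c p w]
    makes it orthogonal to [p] for [b] as well; hence eigenvectors of the pencil
    restricted to [W'] are still eigenvectors on [W]. *)
Lemma exists_orthonormal_eigenbasis b c W :
  pos_def_on W c ->
  exists s, [/\ basis_of W s, {in s &, forall p q, c p q = (p == q)%:R} &
                {in s & W, forall p w, b p w = b p p * c p w}].
Proof.
move: {-1}(\dim W) (leqnn (\dim W)) => m; elim: m W => [|m IHm] W leWm c_pd.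
  exists [::]; split=> //; move: leWm; rewrite leqn0 dimv_eq0 => /eqP->.
  exact: nil_basis.
have [W0|W_neq0] := eqVneq W 0%VS.
  by exists [::]; split=> //; rewrite W0 nil_basis.
have [p [pW cpp eig]] := exists_unit_eigenvector b W_neq0 c_pd.
pose W' := (W :&: orthov c <[p]>)%VS.
have pW' : p \notin W' by rewrite memv_cap mem_orthov1 cpp oner_eq0 andbF.
have subW' : (W' <= W)%VS := capvSl _ _.
(* [w] is the sum of its component [c w p *: p] and a remainder in [W']. *)
have W_split : W = (<[p]> + W')%VS.
  apply/eqP; rewrite eqEsubv subv_add subW' -memvE pW !andbT.
  apply/subvP => w wW; rewrite -(subrKC (c w p *: p) w).
  have p1 : basis_of <[p]> [:: p].
    by apply: seq1_basis; apply: contraNneq pW' => ->; rewrite mem0v.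
  rewrite memv_add ?memvZ ?memv_line// memv_cap memvB ?memvZ//=.
  have /(_ w) := sub_proj_orthov (f := c) _ p1; rewrite big_seq1; apply.
  by move=> q q'; rewrite !inE => /eqP-> /eqP->; rewrite eqxx.
have [||s [sW' cs eigs]] := IHm W'.
- rewrite -ltnS; apply: leq_trans leWm; rewrite ltnNge.
  by apply: contra pW' => dimW; rewrite (eqP (_ : W' == W)) ?eqEdim ?subW'.
- by move=> w /(subvP subW'); apply: c_pd.
have cps q : q \in s -> c p q = 0.
  move=> /(basis_mem sW'); rewrite memv_cap mem_orthov1 => /andP[_ /eqP].
  by rewrite sym_formC.
have ps : p \notin s by apply: contra pW'; apply: basis_mem.
exists (p :: s); split.
- rewrite /basis_of span_cons free_cons (span_basis sW') -W_split eqxx pW' /=.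
  exact: basis_free sW'.
- move=> q r; rewrite !inE => /orP[/eqP->|qs] /orP[/eqP->|rs]; last exact: cs.
  + by rewrite cpp eqxx.
  + by rewrite cps// (negbTE (memPnC ps _ rs)).
  + by rewrite sym_formC cps// (negbTE (memPn ps _ qs)).
move=> q w; rewrite inE => /orP[/eqP->|qs]; first exact: eig.
rewrite {1}W_split => /memv_addP[_ /vlineP[k ->] [w' w'W' ->]].
have /(subvP subW') qW := basis_mem sW' qs.
rewrite !linearDr /= !linearZr /= (eigs _ w')//.
by rewrite (sym_formC b q p) eig// (sym_formC c q p) cps// !mulr0 !add0r.
Qed.

(** The orthonormal basis of [U] used for the projection comes from
    [exists_orthonormal_eigenbasis] with both forms equal to [f]; the
    intersection is trivial because its vectors are isotropic in [U]. *)
Lemma orthov_pos_def_split f U :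
  pos_def_on U f -> (orthov f U + U = fullv)%VS /\ (orthov f U :&: U = 0)%VS.
Proof.
move=> f_pd; split.
  have [s [sU fs _]] := exists_orthonormal_eigenbasis f f_pd.
  apply/eqP; rewrite eqEsubv subvf; apply/subvP => v _.
  rewrite -(subrK (\sum_(p <- s) f v p *: p) v) memv_add ?sub_proj_orthov//.
  by rewrite big_seq memv_suml// => p ps; rewrite memvZ ?(basis_mem sU).
apply/eqP; rewrite -subv0; apply/subvP => v; rewrite memv_cap memv0.
case/andP => /mem_orthovP fv vU; apply: contraT => /(f_pd v vU).
by rewrite fv ?ltxx.
Qed.

(** The Cauchy-Schwarz inequality [c v w ^+ 2 <= c v v * c w w] forces it. *)
Lemma psd_isotropic_mem_ker c v :
  pos_semidef c -> c v v = 0 -> v \in form_ker c.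
Proof.
move=> c_psd cv0; apply/mem_form_kerP => w.
pose x := c v w; pose d := c w w; have d_ge0 : 0 <= d := c_psd w.
(* With [c v v = 0], this vector has square norm [- x ^+ 2 * (d + 2)]; the
   coefficient [d + 1] stands in for [d], so that the bound is still of use when
   [d = 0]. *)
have := c_psd ((d + 1) *: v - x *: w).
rewrite linearBl !linearBr /= !linearZl /= !linearZr /=.
rewrite cv0 (sym_formC c w v) -/x -/d => xd.
have x2 : x ^+ 2 * (d + 2) <= 0 by nra.
have x2_le0 : x ^+ 2 <= 0.
  by move: x2; rewrite pmulr_lle0// ltr_wpDl.
by apply/eqP; rewrite -sqrf_eq0 eq_le x2_le0 sqr_ge0.
Qed.

(** The Kronecker-delta form of orthonormality depends only on the set of
    entries of [s], so it passes at once to a sorted copy; [orthonormal] is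
    defined by recursion along the sequence. *)
Lemma orthonormal_delta f s :
  uniq s -> {in s &, forall p q, f p q = (p == q)%:R} -> orthonormal f s.
Proof.
move=> s_uniq fs; apply/andP; split.
  by apply/allP => p ps /=; rewrite fs// eqxx.
elim: s s_uniq fs => //= p s IHs /andP[ps s_uniq] fs; apply/andP; split.
  rewrite /ortho_rec /= andbT; apply/allP => q qs /=.
  by rewrite fs ?inE ?eqxx ?qs ?orbT// (negbTE (memPnC ps _ qs)).
by apply: IHs => // q r qs rs; rewrite fs// inE ?qs ?rs orbT.
Qed.

End SymmetricForms.

(** * The generalised eigenvalue problem *)

Theorem theorem2p9 (R : realType) (V : vectType R) (b c : {symmetric V})
    (n s : nat) (dimV : \dim {:V} = n) (dim_ker : \dim (form_ker c) = s)
    (lt_sn : (s < n)%N) (c_psd : pos_semidef c)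
    (b_pd : (1 <= s)%N -> pos_def_on (form_ker c) b) :
  exists (p : n.-tuple V) (lambda : 'I_(n - s) -> R),
    let fin_idx : 'I_(n - s) -> 'I_n := widen_ord (leq_subr s n) in
    [/\ basis_of {:V} p,
        (forall j, gen_eigenpair b c (lambda j) (tnth p (fin_idx j))),
        orthonormal c (take (n - s) p),
        (forall i j : 'I_(n - s), (i <= j)%N -> lambda i <= lambda j) &
        basis_of (form_ker c) (drop (n - s) p)]
    /\ [/\ (forall (j : 'I_(n - s)) (j' : 'I_n),
              b (tnth p (fin_idx j)) (tnth p j')
              = lambda j * (fin_idx j == j')%:R),
           (forall (j : 'I_(n - s)) (j' : 'I_n),
              c (tnth p (fin_idx j)) (tnth p j') = (fin_idx j == j')%:R) &
           (s = 0%N -> forall i : 'I_n, exists j : 'I_(n - s),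
              fin_idx j = i /\ gen_eigenpair b c (lambda j) (tnth p i))].
Proof.
set K := form_ker c in dim_ker b_pd *; pose W := orthov b K.
(* When [s = 0], the kernel is trivial and the condition holds vacuously. *)
have bK_pd : pos_def_on K b.
  move=> v vK v_neq0; apply: b_pd => //; rewrite -dim_ker lt0n dimv_eq0.
  by apply: contraNneq v_neq0 => K0; rewrite -memv0 -K0.
have [WK_full WK_cap] : (W + K = fullv)%VS /\ (W :&: K = 0)%VS.
  exact: orthov_pos_def_split.
have cW_pd : pos_def_on W c.
  move=> v vW v_neq0; rewrite lt_def c_psd andbT.
  apply: contra v_neq0 => /eqP/(psd_isotropic_mem_ker c_psd) vK.
  by rewrite -memv0 -WK_cap memv_cap vW.
have [s0 [s0W cs0 eig0]] := exists_orthonormal_eigenbasis b cW_pd.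
pose leb p q := b p p <= b q q; pose S := sort leb s0.
have leb_total : total leb by move=> p q; exact: le_total.
have leb_trans : transitive leb by move=> q p r; exact: le_trans.
have SW : basis_of W S by rewrite (perm_basis _ (permEl (perm_sort leb s0))).
have cS : {in S &, forall p q, c p q = (p == q)%:R}.
  by move=> p q; rewrite !mem_sort; exact: cs0.
(* [eig0] only tests against [W]; on the other summand [K], both forms vanish
   on [p]. *)
have eigS p v : p \in S -> b p v = b p p * c p v.
  move=> pS; have pW := basis_mem SW pS.
  have := memvf v; rewrite -WK_full => /memv_addP[w wW [k kK ->]].
  have /mem_orthovP/(_ k kK) bpk := pW.
  have /mem_form_kerP/(_ p) ckp := kK.
  rewrite !linearDr /= bpk (sym_formC c p k) ckp !addr0.
  by apply: eig0; rewrite // -(mem_sort leb).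
have sizeS : size S = (n - s)%N.
  have := dimv_disjoint_sum WK_cap; rewrite WK_full dimV dim_ker => ->.
  by rewrite addnK -(span_basis SW) (eqnP (basis_free SW)).
pose P := S ++ vbasis K.
have sizeP : size P == n.
  by rewrite size_cat sizeS size_tuple dim_ker subnK// ltnW.
have P_basis : basis_of {:V} P.
  rewrite -WK_full; apply: cat_basis => //; last exact: vbasisP.
  by apply/directv_addP.
(* When [q] is in [K], [c p q = 0] excludes [p = q] since [c p p = 1]. *)
have cSP p q : p \in S -> q \in P -> c p q = (p == q)%:R.
  move=> pS; rewrite mem_cat => /orP[qS|/vbasis_mem qK]; first exact: cS.
  have /mem_form_kerP/(_ p) := qK; rewrite sym_formC => cpq.
  rewrite cpq; case: eqP => // pq.
  by move: cpq; rewrite -pq cS// eqxx => /eqP; rewrite oner_eq0.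
pose p := Tuple sizeP; pose fin_idx := widen_ord (leq_subr s n).
have p_fin j : tnth p (fin_idx j) = S`_j.
  by rewrite (tnth_nth 0) /= nth_cat sizeS ltn_ord.
have p_finS j : tnth p (fin_idx j) \in S.
  by rewrite p_fin mem_nth// sizeS.
have cP j j' : c (tnth p (fin_idx j)) (tnth p j') = (fin_idx j == j')%:R.
  rewrite cSP// ?mem_tnth// !(tnth_nth 0) /= nth_uniq ?(eqP sizeP)//.
    exact: leq_trans (ltn_ord j) (leq_subr s n).
  exact: free_uniq (basis_free P_basis).
pose lambda (j : 'I_(n - s)) := b S`_j S`_j.
have bP j v : b (tnth p (fin_idx j)) v = lambda j * c (tnth p (fin_idx j)) v.
  by rewrite eigS// p_fin.
have eigP j : gen_eigenpair b c (lambda j) (tnth p (fin_idx j)).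
  by split=> //; apply: basis_not0 SW (p_finS j).
exists p, lambda; split; split=> //.
- rewrite /= take_size_cat//; apply: orthonormal_delta cS.
  exact: free_uniq (basis_free SW).
- move=> i j ij; apply: (sorted_leq_nth leb_trans) => //.
  + by move=> q; exact: lexx.
  + exact: sort_sorted.
  + by rewrite inE sizeS.
  + by rewrite inE sizeS.
- by rewrite /= drop_size_cat//; exact: vbasisP.
- by move=> j j'; rewrite bP cP.
move=> s0_eq i; have i_fin : (i < n - s)%N by rewrite s0_eq subn0.
exists (Ordinal i_fin).
have fin_i : fin_idx (Ordinal i_fin) = i by exact: val_inj.
by split=> //; have := eigP (Ordinal i_fin); rewrite fin_i.
Qed.
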